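(* Let $\Sigma\subseteq\mathbb{R}^d$ be a closed convex set, let $g_0,h_0,g_1,h_1:\Sigma\to\mathbb{R}$ be convex functions with $g_1$ $L$-smooth (i.e. $\nabla g_1$ is Lipschitz continuous with constant $L$ on $\Sigma$), and consider $$(\mathrm{DC})\qquad \min_{z\in\Sigma}\ f_0(z):=g_0(z)-h_0(z)\quad\text{s.t.}\quad f_1(z):=g_1(z)-h_1(z)\le 0 .$$ Suppose $f_0$ is bounded below, the sequences $\{z^k\}$ and $\{\beta_k\}$ generated by the algorithm iPL-DCA (described in the context) are bounded, and the functions $g_0,h_1,h_0$ are locally Lipschitz on the set $\Sigma$. Then every accumulation point of $\{z^k\}$ is a KKT point of problem (DC).
   Context: $\partial$ is the subdifferential and $\mathcal N_\Sigma$ the normal cone of convex analysis; $\mathrm{dist}(x,M)$ is the distance from $x$ to the set $M$. ''Locally Lipschitz on $\Sigma$'' means Lipschitz around (on a neighbourhood of) each point of $\Sigma$, the functions being regarded as defined there. KKT point: a feasible point $\bar z$ of (DC) is a stationary/KKT point if there is $\lambda\ge 0$ such that $0\in\partial g_0(\bar z)-\partial h_0(\bar z)+\lambda(\partial g_1(\bar z)-\partial h_1(\bar z))+\mathcal N_\Sigma(\bar z)$ and $(g_1(\bar z)-h_1(\bar z))\lambda=0$. Algorithm iPL-DCA: fix $\delta_\beta>0$, $\sigma>0$, $\beta_0>0$, $z^0\in\Sigma$, and set $\rho_0=\frac12\beta_0L+\sigma$. For $k=0,1,\dots$: 1. Choose $\xi_i^k\in\partial h_i(z^k)$, $i=0,1$.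 2. Let $\hat\varphi_k(z):=g_0(z)-h_0(z^k)-\langle\xi_0^k,z-z^k\rangle+\frac{\rho_k}{2}\|z-z^k\|^2+\beta_k\max\{g_1(z^k)+\langle\nabla g_1(z^k),z-z^k\rangle-h_1(z^k)-\langle\xi_1^k,z-z^k\rangle,0\}$ and choose $z^{k+1}\in\Sigma$ as an approximate minimizer of $\hat\varphi_k$ over $\Sigma$ satisfying one of the two criteria: (I) $\mathrm{dist}(0,\partial\hat\varphi_k(z^{k+1})+\mathcal N_\Sigma(z^{k+1}))\le\zeta_k$, where $\zeta_k\ge 0$ and $\sum_{k=0}^\infty\zeta_k^2<\infty$; (II) $\mathrm{dist}(0,\partial\hat\varphi_k(z^{k+1})+\mathcal N_\Sigma(z^{k+1}))\le\frac{\sqrt2}{2}\sigma\|z^k-z^{k-1}\|$ (meaningful for $k\ge1$). 3. Set $t^{k+1}:=\max\{g_1(z^k)+\langle\nabla g_1(z^k),z^{k+1}-z^k\rangle-h_1(z^k)-\langle\xi_1^k,z^{k+1}-z^k\rangle,0\}$. 4. Set $\beta_{k+1}=\beta_k+\delta_\beta$ if $\max\{\beta_k,1/t^{k+1}\}<\|z^{k+1}-z^k\|^{-1}$ and $\beta_{k+1}=\beta_k$ otherwise (with $1/0=+\infty$); set $\rho_{k+1}=\frac12\beta_{k+1}L+\sigma$. (In practice the procedure is stopped when $\max\{\|z^{k+1}-z^k\|,t^{k+1}\}$ is below a tolerance; for the convergence statement this test is disregarded and the infinite sequence is considered.) *)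

(* Defs.v *)
From HB Require Import structures.
From mathcomp Require Import all_boot all_order all_algebra.
From mathcomp Require Import all_classical all_reals all_analysis.
Import Order.TTheory GRing.Theory Num.Theory.
Import numFieldNormedType.Exports.

Set Implicit Arguments.
Unset Strict Implicit.
Unset Printing Implicit Defensive.

Local Open Scope classical_set_scope.
Local Open Scope ring_scope.

(* The library norm [`|x|] on ['rV[R]_d] is the sup norm.  It is used below only
   for notions that do not depend on the norm (topology, boundedness,
   differentiability, Lipschitz with an unspecified constant); every
   quantitative expression uses the Euclidean norm [enorm]. *)
Section Euclidean.
Context {R : realType} {d : nat}.
Implicit Types (x y u v : 'rV[R]_d) (M : set 'rV[R]_d).

Definition dotv u v : R := \sum_(i < d) u ord0 i * v ord0 i.

Definition enorm u : R := Num.sqrt (dotv u u).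

(* Extended-real valued, so that the distance to the empty set is [+oo]. *)
Definition dist x M : \bar R := ereal_inf [set (enorm (x - y))%:E | y in M].

Definition grad (f : 'rV[R]_d -> R) x : 'rV[R]_d :=
  \row_(i < d) 'D_(delta_mx ord0 i) f x.

End Euclidean.

(* A convex function with effective domain [D] is represented by a total
   function together with [D]; its values outside [D] are never used. *)
Section ConvexAnalysis.
Context {R : realType} {d : nat}.
Implicit Types (x y v : 'rV[R]_d) (D Sigma : set 'rV[R]_d)
  (f : 'rV[R]_d -> R).

Definition subdiff D f x : set 'rV[R]_d :=
  [set v | D x /\ forall y, D y -> f x + dotv v (y - x) <= f y].

Definition normal_cone Sigma x : set 'rV[R]_d :=
  [set v | Sigma x /\ forall y, Sigma y -> dotv v (y - x) <= 0].

(* The neighbourhood is a full one, not relative to [Sigma] (unlike the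
   library's [[locally [lipschitz f x | x in Sigma]]]), and lies in [D]. *)
Definition locally_lipschitz_on D Sigma f : Prop :=
  forall x, Sigma x ->
    exists V : set 'rV[R]_d, [/\ nbhs x V, V `<=` D & [lipschitz f y | y in V]].

Definition smooth_on D Sigma (L : R) f : Prop :=
  [/\ 0 <= L,
      forall x, Sigma x -> nbhs x D /\ differentiable f x &
      forall x y, Sigma x -> Sigma y ->
        enorm (grad f x - grad f y) <= L * enorm (x - y)].

End ConvexAnalysis.

Section DC.
Context {R : realType} {d : nat}.
Variables (D Sigma : set 'rV[R]_d) (g0 h0 g1 h1 : 'rV[R]_d -> R).

(* KKT points of: minimize g0 - h0 over [Sigma] subject to g1 - h1 <= 0. *)
Definition is_KKT (zb : 'rV[R]_d) : Prop :=
  [/\ Sigma zb, g1 zb - h1 zb <= 0 &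
      exists lambda : R,
        [/\ 0 <= lambda,
            exists u0 v0 u1 v1 n : 'rV[R]_d,
              [/\ subdiff D g0 zb u0 /\ subdiff D h0 zb v0,
                  subdiff D g1 zb u1 /\ subdiff D h1 zb v1,
                  normal_cone Sigma zb n &
                  0 = u0 - v0 + lambda *: (u1 - v1) + n] &
            (g1 zb - h1 zb) * lambda = 0]].

(* Here and below [w], [xi0], [xi1] stand for z^k, xi_0^k, xi_1^k. *)
Definition lin_viol (w xi1 z : 'rV[R]_d) : R :=
  Num.max (g1 w + dotv (grad g1 w) (z - w) - h1 w - dotv xi1 (z - w)) 0.

Definition phi_hat (w xi0 xi1 : 'rV[R]_d) (beta rho : R) (z : 'rV[R]_d) : R :=
  g0 z - h0 w - dotv xi0 (z - w) + rho / 2 * enorm (z - w) ^+ 2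
  + beta * lin_viol w xi1 z.

Definition stationarity_residual (w xi0 xi1 : 'rV[R]_d) (beta rho : R)
    (z : 'rV[R]_d) : \bar R :=
  dist 0 [set u + n | u in subdiff D (phi_hat w xi0 xi1 beta rho) z
                    & n in normal_cone Sigma z].

Record is_iPL_DCA (L delta_beta sigma : R) (zeta : R^nat)
    (z xi0 xi1 : nat -> 'rV[R]_d) (beta rho : R^nat) : Prop := {
  delta_beta_gt0 : 0 < delta_beta;
  sigma_gt0 : 0 < sigma;
  beta0_gt0 : 0 < beta 0%N;
  zeta_ge0 : forall k, 0 <= zeta k;
  zeta_summable : cvgn (series (fun k => zeta k ^+ 2));
  z_in : forall k, Sigma (z k);
  rhoE : forall k, rho k = beta k * L / 2 + sigma;
  xi0_subdiff : forall k, subdiff D h0 (z k) (xi0 k);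
  xi1_subdiff : forall k, subdiff D h1 (z k) (xi1 k);
  (* Either criterion may be used at each iteration.  The second one refers to
     z^(k-1) and therefore imposes nothing at k = 0. *)
  inexact : forall k,
    let r := stationarity_residual (z k) (xi0 k) (xi1 k) (beta k) (rho k)
               (z k.+1) in
    (r <= (zeta k)%:E)%E \/
    ((0 < k)%N ->
       (r <= (Num.sqrt 2 / 2 * sigma * enorm (z k - z k.-1))%:E)%E);
  (* The inverses are taken in [\bar R], where 0^-1 = +oo. *)
  betaE : forall k,
    let t := lin_viol (z k) (xi1 k) (z k.+1) in
    beta k.+1 =
      if (maxe (beta k)%:E (t%:E)^-1 < ((enorm (z k.+1 - z k))%:E)^-1)%E
      then beta k + delta_beta else beta k
}.

End DC.

(* Main.v *)
Require Import Defs.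
From HB Require Import structures.
From mathcomp Require Import all_boot all_order all_algebra.
From mathcomp Require Import all_classical all_reals all_analysis.
From mathcomp Require Import ring lra.
Import Order.TTheory GRing.Theory Num.Theory.
Import numFieldNormedType.Exports.

Set Implicit Arguments.
Unset Strict Implicit.
Unset Printing Implicit Defensive.

Local Open Scope classical_set_scope.
Local Open Scope ring_scope.

(** The theorem rests on two observations: a penalty function decreases along
    the iterates by a multiple of the squared step, and a limit of the convex
    subproblems is a convex problem whose optimality condition is exactly the
    KKT system.

    Descent.  The model minimized at step k majorizes the exact penalty function
    f0 + beta_k max(f1, 0), up to a quadratic term (convexity of h0 and h1, and
    the descent lemma for g1), and agrees with it at z^k.  The model is strongly
    convex, so the stopping criterion is a variational inequality with a
    quadratic gain [residual_variational_inequality], and the two facts together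
    give a decrease of sigma |z^(k+1) - z^k|^2 minus the error allowed by the
    criterion [merit_decrease].  The parameters beta_k grow by fixed amounts and
    stay bounded, hence are eventually constant; from then on the penalty
    function is the same at every step, the errors can be telescoped or summed,
    and the steps tend to 0 [step_cvg0].  As the update of beta_k is no longer
    triggered, the linearized constraint violation is eventually at most the
    step, so it tends to 0 as well [viol_le_step].

    Passage to the limit.  The subgradients of h0 and h1 are bounded near an
    accumulation point zb, because these functions are Lipschitz there.  Along
    an ultrafilter on the indices, finer than the filter at infinity, the
    iterates converge to zb and the subgradients to some v0 and v1.  The limit
    of the variational inequalities says that zb minimizes over Sigma the function
    g0 - <v0, .> + beta max(linearization of f1 at zb, 0); the quadratic gain
    cancels the proximal term.  Using the inequalities rather than subgradients
    of the models avoids decomposing the latter at each step.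

    Multipliers.  Two convexity arguments turn this minimality into the KKT
    conditions.  The penalty max(G, 0) of an affine function G may be replaced
    by mu G for some mu in [0, 1] [affine_multiplier]; evaluating at zb shows
    that beta mu satisfies complementarity.  Then a minimizer over Sigma of a
    convex function, Lipschitz near it, has a subgradient whose opposite is
    normal to Sigma [subdiff_normal_cone_sum]; this is the finite-dimensional
    Hahn-Banach theorem in the form [sublinear_cone_separation]. *)

(** * Euclidean inner product and norm *)

Section Euclidean.
Context {R : realType} {d : nat}.
Implicit Types (u v w x y : 'rV[R]_d) (t : R).

Lemma dotvC u v : dotv u v = dotv v u.
Proof. by apply: eq_bigr => i _; rewrite mulrC. Qed.

Lemma dotvDl u v w : dotv (u + v) w = dotv u w + dotv v w.
Proof. by rewrite -big_split; apply: eq_bigr => i _; rewrite mxE mulrDl. Qed.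

Lemma dotvZl t u v : dotv (t *: u) v = t * dotv u v.
Proof. by rewrite mulr_sumr; apply: eq_bigr => i _; rewrite mxE mulrA. Qed.

Lemma dotvDr u v w : dotv u (v + w) = dotv u v + dotv u w.
Proof. by rewrite dotvC dotvDl !(dotvC u). Qed.

Lemma dotvZr t u v : dotv u (t *: v) = t * dotv u v.
Proof. by rewrite dotvC dotvZl dotvC. Qed.

Lemma dotvNl u v : dotv (- u) v = - dotv u v.
Proof. by rewrite -scaleN1r dotvZl mulN1r. Qed.

Lemma dotvNr u v : dotv u (- v) = - dotv u v.
Proof. by rewrite dotvC dotvNl dotvC. Qed.

Lemma dotv0r u : dotv u 0 = 0.
Proof. by rewrite -(scale0r 0) dotvZr mul0r. Qed.

Definition dotvE :=
  (dotvDl, dotvDr, dotvNl, dotvNr, dotvZl, dotvZr, dotv0r).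

Lemma dotv_ge0 u : 0 <= dotv u u.
Proof. by apply: sumr_ge0 => i _; rewrite -expr2 sqr_ge0. Qed.

Lemma enorm_ge0 u : 0 <= enorm u.
Proof. exact: sqrtr_ge0. Qed.

Lemma enormE u : enorm u ^+ 2 = dotv u u.
Proof. by rewrite sqr_sqrtr ?dotv_ge0. Qed.

Lemma enorm0 : enorm (0 : 'rV[R]_d) = 0.
Proof. by rewrite /enorm dotv0r sqrtr0. Qed.

Lemma enormZ t u : enorm (t *: u) = `|t| * enorm u.
Proof.
by rewrite /enorm !dotvE mulrA -expr2 sqrtrM ?sqr_ge0// sqrtr_sqr.
Qed.

Lemma enormN u : enorm (- u) = enorm u.
Proof. by rewrite -scaleN1r enormZ normrN1 mul1r. Qed.

Lemma coord_le_enorm u i : `|u ord0 i| <= enorm u.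
Proof.
rewrite -(sqrtr_sqr (u ord0 i)) ler_wsqrtr// expr2 /dotv (bigD1 i)//= lerDl.
by apply: sumr_ge0 => j _; rewrite -expr2 sqr_ge0.
Qed.

Lemma enorm_eq0 u : enorm u = 0 -> u = 0.
Proof.
move=> u0; apply/rowP => i; rewrite mxE; apply/eqP.
by rewrite -normr_le0 -u0 coord_le_enorm.
Qed.

Lemma cauchy_schwarz u v : dotv u v <= enorm u * enorm v.
Proof.
have [/enorm_eq0 ->|u0] := eqVneq (enorm u) 0.
  by rewrite enorm0 dotvC dotv0r mul0r.
have [/enorm_eq0 ->|v0] := eqVneq (enorm v) 0.
  by rewrite enorm0 dotv0r mulr0.
have uv_gt0 : 0 < enorm u * enorm v by rewrite mulr_gt0// lt0r enorm_ge0 andbT.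
have := dotv_ge0 (enorm v *: u - enorm u *: v).
rewrite !dotvE -!enormE (dotvC v u) => h.
rewrite -(ler_pM2l uv_gt0) -subr_ge0.
by rewrite -(pmulr_rge0 _ (ltr0n R 2)); move: h; lra.
Qed.

End Euclidean.

(** * Separating a sublinear function from a convex cone *)

Section Separation.
Context {R : realType} {d : nat}.
Implicit Types (q : 'rV[R]_d -> R) (C : 'rV[R]_d -> R -> Prop).

Definition sublinear q :=
  (forall u v, q (u + v) <= q u + q v) /\
  (forall t u, 0 < t -> q (t *: u) <= t * q u).

(** Convex cones of the product of the vector space with [R], as relations. *)
Definition cone C :=
  [/\ C 0 0,
      forall w1 s1 w2 s2, C w1 s1 -> C w2 s2 -> C (w1 + w2) (s1 + s2) &
      forall t w s, 0 < t -> C w s -> C (t *: w) (t * s)].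

Lemma sublinear0 q : sublinear q -> q 0 = 0.
Proof.
move=> [qD qZ]; have := qD 0 0; rewrite addr0 => h1.
have := qZ 2^-1 0; rewrite scaler0 => /(_ ltac:(by [])) h2; lra.
Qed.

Lemma sublinearZ q t u : sublinear q -> 0 <= t -> q (t *: u) = t * q u.
Proof.
move=> sq; have [qD qZ] := sq; rewrite le_eqVlt => /predU1P[<-|t0].
  by rewrite scale0r mul0r sublinear0.
apply/eqP; rewrite eq_le qZ//= -ler_pdivlMl//.
apply: le_trans (qZ t^-1 (t *: u) _); last by rewrite invr_gt0.
by rewrite scalerA mulVf ?gt_eqF// scale1r.
Qed.

(** Lowering a sublinear function to meet new constraints: q' is the infimal
    convolution of q with the cone, bounded below at v by - q (- v).
    It serves twice, to linearize q along one axis and to absorb the cone to be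
    separated from q. *)
Lemma sublinear_minorant q C : sublinear q -> cone C ->
    (forall w s, C w s -> 0 <= q w + s) ->
  exists q', [/\ sublinear q', forall v, q' v <= q v &
                 forall w s, C w s -> q' (- w) <= s].
Proof.
move=> sq [C0 CD CZ] qC; have [qD qZ] := sq.
pose A v := [set r | exists w s, C w s /\ r = q (v + w) + s].
pose q' v := inf (A v).
have Alb v : has_inf (A v).
  split; first by exists (q (v + 0) + 0), 0, 0.
  exists (- q (- v)) => _ [w [s [Cws ->]]].
  have := qD (v + w) (- v); rewrite addrAC subrr add0r => h.
  have := qC w s Cws; lra.
have q'le v w s : C w s -> q' v <= q (v + w) + s.
  by move=> Cws; apply: ge_inf; [case: (Alb v)|exists w, s].
have leq' v r : (forall w s, C w s -> r <= q (v + w) + s) -> r <= q' v.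
  by move=> h; apply: lb_le_inf; [case: (Alb v)|move=> _ [w [s [/h + ->]]]].
exists q'; split=> [|v|w s Cws].
- split=> [u v|t u t0].
  + rewrite -lerBlDl; apply/leq' => w1 s1 C1.
    rewrite lerBlDl -lerBlDr; apply/leq' => w2 s2 C2.
    rewrite lerBlDr; apply: le_trans (q'le _ _ _ (CD _ _ _ _ C1 C2)) _.
    have := qD (u + w2) (v + w1).
    by rewrite addrACA (addrC w2); lra.
  + rewrite -ler_pdivrMl//; apply/leq' => w s Cws; rewrite ler_pdivrMl//.
    apply: le_trans (q'le _ _ _ (CZ _ _ _ t0 Cws)) _.
    by rewrite -scalerDr mulrDr lerD2r qZ.
- by have := q'le v _ _ C0; rewrite !addr0.
- by have := q'le (- w) _ _ Cws; rewrite addNr sublinear0// add0r.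
Qed.

(** Hahn-Banach in finite dimension.  Coordinate after coordinate, q is replaced
    by a smaller sublinear function that is odd on the axis e.  By
    subadditivity oddness amounts to q (- e) <= - q e, a property that smaller
    sublinear functions inherit, so it survives on the earlier axes.  A
    sublinear function that is odd on every axis is linear. *)
Lemma sublinear_dominates_linear q : sublinear q ->
  exists u : 'rV[R]_d, forall v, dotv u v <= q v.
Proof.
move=> sq.
have [q' [sq' q'q q'N]] : exists q', [/\ sublinear q', forall v, q' v <= q v &
    forall i : 'I_d, q' (- delta_mx ord0 i) <= - q' (delta_mx ord0 i)].
  suff H n : exists q', [/\ sublinear q', forall v, q' v <= q v &
      forall i : 'I_d, (i < n)%N ->
        q' (- delta_mx ord0 i) <= - q' (delta_mx ord0 i)].
    by have [q' [? ? H']] := H d; exists q'; split=> // i; exact: H'.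
  elim: n => [|n [q1 [sq1 q1q q1N]]]; first by exists q.
  have [nd|dn] := ltnP n d; last first.
    exists q1; split=> // i _; apply: q1N.
    exact: leq_trans (ltn_ord i) dn.
  pose e : 'rV[R]_d := delta_mx ord0 (Ordinal nd).
  (* This cone imposes q' (- e) <= - q1 e, whence oddness at e. *)
  pose C w s := exists2 t : R, 0 <= t & w = t *: e /\ s = t * - q1 e.
  have [q2 [sq2 q2q1 q2C]] : exists q', [/\ sublinear q',
      forall v, q' v <= q1 v & forall w s, C w s -> q' (- w) <= s].
    apply: sublinear_minorant => //.
    - split.
      + by exists 0; rewrite // scale0r mul0r.
      + move=> _ _ _ _ [t1 t10 [-> ->]] [t2 t20 [-> ->]].
        by exists (t1 + t2); [exact: addr_ge0|rewrite scalerDl mulrDl].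
      + move=> t _ _ t0 [t1 t10 [-> ->]]; exists (t * t1).
          by rewrite mulr_ge0// ltW.
        by rewrite scalerA mulrA.
    - by move=> _ _ [t t0 [-> ->]]; rewrite sublinearZ// mulrN subrr.
  exists q2; split=> // [v|i]; first exact: le_trans (q1q v).
  rewrite ltnS leq_eqVlt => /predU1P[ni|/q1N h].
    have -> : i = Ordinal nd by exact: val_inj.
    apply: le_trans (q2C e (- q1 e) _) _; last by rewrite lerN2.
    by exists 1 => //; rewrite scale1r mul1r.
  by apply: le_trans (q2q1 _) (le_trans h _); rewrite lerN2.
exists (\row_i q' (delta_mx ord0 i)) => v; apply: le_trans (q'q v).
have q'D := sq'.1.
have q'sum (I : seq 'I_d) (F : 'I_d -> 'rV[R]_d) :
    q' (\sum_(i <- I) F i) <= \sum_(i <- I) q' (F i).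
  elim: I => [|i I IH]; first by rewrite !big_nil sublinear0.
  by rewrite !big_cons; apply: le_trans (q'D _ _) _; rewrite lerD2l.
have : q' (- v) <= - dotv (\row_i q' (delta_mx ord0 i)) v.
  have -> : - v = \sum_(i < d) (- v ord0 i) *: delta_mx ord0 i.
    by rewrite [LHS]row_sum_delta; apply: eq_bigr => i _; rewrite mxE.
  apply: le_trans (q'sum _ _) _; rewrite -sumrN ler_sum// => i _; rewrite mxE.
  have [vi|vi] := leP (v ord0 i) 0.
    by rewrite sublinearZ ?oppr_ge0//; lra.
  rewrite scaleNr -scalerN sublinearZ ?(ltW vi)//.
  by apply: le_trans (ler_wpM2l (ltW vi) (q'N i)) _; rewrite mulrN mulrC.
have := q'D v (- v); rewrite subrr sublinear0//; lra.
Qed.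

Lemma sublinear_cone_separation q C : sublinear q -> cone C ->
    (forall w s, C w s -> 0 <= q w + s) ->
  exists u : 'rV[R]_d, (forall v, dotv u v <= q v) /\
                       (forall w s, C w s -> - dotv u w <= s).
Proof.
move=> sq cC qC; have [q' [sq' q'q q'C]] := sublinear_minorant sq cC qC.
have [u uq'] := sublinear_dominates_linear sq'.
exists u; split=> [v|w s Cws]; first exact: le_trans (uq' v) (q'q v).
by rewrite -dotvNr; exact: le_trans (uq' _) (q'C _ _ Cws).
Qed.

End Separation.

(** * Optimality condition over a convex set *)

Section Convexity.
Context {R : realType} {d : nat}.
Implicit Types (D Sigma V : set 'rV[R]_d) (f : 'rV[R]_d -> R)
  (x y : 'rV[R]_d) (t : R).

Lemma segmentE x y t : x + t *: (y - x) = t *: y + (1 - t) *: x.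
Proof. by rewrite scalerBr scalerBl scale1r addrCA (addrC x). Qed.

Lemma convex_set_segment D x y t : convex_set D -> D x -> D y ->
  0 <= t -> t <= 1 -> D (x + t *: (y - x)).
Proof.
move=> cD Dx Dy t0 t1; rewrite segmentE.
by have := cD y x (Itv01 t0 t1); rewrite !inE; exact.
Qed.

Lemma convex_function_segment D f x y t :
  convex_function D f -> D x -> D y -> 0 <= t -> t <= 1 ->
  f (x + t *: (y - x)) <= f x + t * (f y - f x).
Proof.
move=> cf Dx Dy t0 t1; rewrite segmentE.
have -> : f x + t * (f y - f x) = t * f y + (1 - t) * f x by ring.
by have := cf (Itv01 t0 t1) y x; rewrite !inE; exact.
Qed.

Lemma locally_lipschitz_ball D Sigma f x :
    locally_lipschitz_on D Sigma f -> Sigma x ->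
  exists K e : R, [/\ 0 < K, 0 < e, ball x e `<=` D &
    forall y z, ball x e y -> ball x e z -> `|f y - f z| <= K * `|y - z|].
Proof.
move=> lipf /lipf [V [/nbhs_ballP[e /= e0 eV] VD lipV]].
have [K [K0 KV]] : exists K, 0 < K /\ K.-lipschitz_V f.
  near (pinfty_nbhs R) => K; exists K.
  by split; near: K => //; exact: nbhs_pinfty_gt.
exists K, e; split=> //; first exact: subset_trans VD.
by move=> y z /eV Vy /eV Vz; exact: (KV (y, z)).
Unshelve. all: by end_near. Qed.

Lemma near0_segment_ball x u (e : R) : 0 < e ->
  \forall t \near 0^'+, ball x e (x + t *: u).
Proof.
move=> e0; have M0 : 0 < 1 + `|u| by rewrite ltr_pwDl.
near=> t; have t0 : 0 < t by near: t; exact: nbhs_right_gt.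
rewrite -ball_normE /= opprD addrA subrr add0r normrN normrZ gtr0_norm//.
apply: (@le_lt_trans _ _ (t * (1 + `|u|))); first by rewrite ler_pM2l// lerDr.
rewrite -ltr_pdivlMr//; near: t; apply: nbhs_right_lt.
by rewrite divr_gt0.
Unshelve. all: by end_near. Qed.

Lemma near0_scaled_le1 (a : R) : \forall t \near 0^'+, t * a <= 1.
Proof.
have M0 : 0 < 1 + `|a| by rewrite ltr_pwDl.
near=> t; have t0 : 0 < t by near: t; exact: nbhs_right_gt.
apply: (@le_trans _ _ (t * (1 + `|a|))).
  by rewrite ler_pM2l//; have := ler_norm a; lra.
rewrite -ler_pdivlMr//; near: t; apply: nbhs_right_le.
by rewrite divr_gt0.
Unshelve. all: by end_near. Qed.

(** The weight t depends only on the coefficients, so that the same one serves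
    for points and for values of a convex function at these points. *)
Lemma conic_combination_weight (a1 a2 : R) : 0 <= a1 -> 0 <= a2 ->
  exists t, [/\ 0 <= t, t <= 1, (a1 + a2) * t = a2 &
    forall y1 y2 z : 'rV[R]_d, (a1 + a2) *: (y1 + t *: (y2 - y1) - z) =
                               a1 *: (y1 - z) + a2 *: (y2 - z)].
Proof.
move=> a10 a20.
have [t [t0 t1 ta]] : exists t, [/\ 0 <= t, t <= 1 & (a1 + a2) * t = a2].
  have [a0|a0] := eqVneq (a1 + a2) 0; first by exists 0; split=> //; lra.
  exists (a2 / (a1 + a2)); rewrite (mulrC (_ + _)) divfK// divr_ge0 ?addr_ge0//.
  by split=> //; rewrite ler_pdivrMr ?lt0r ?a0 ?addr_ge0//; lra.
exists t; split=> // y1 y2 z.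
have -> : y1 + t *: (y2 - y1) - z = (y1 - z) + t *: (y2 - y1).
  by rewrite addrAC.
by rewrite scalerDr scalerA ta; apply/rowP => i; rewrite !mxE; ring.
Qed.

(** Sum rule at a minimizer.  The subgradient u has to satisfy
    <u, y - zb> <= f y - f zb on D and <u, x - zb> >= - <c, x - zb> on Sigma.
    Both families of inequalities generate a convex cone C, and the separation
    lemma with q = K * norm, K a Lipschitz constant of f near zb, yields u.  The
    compatibility of q with C is tested on points shrunk towards zb, where the
    Lipschitz bound holds and where minimality compares a point of Sigma with a
    nearby point of D. *)
Lemma subdiff_normal_cone_sum D Sigma f (c zb : 'rV[R]_d) :
    convex_set D -> convex_set Sigma -> Sigma `<=` D -> convex_function D f ->
    locally_lipschitz_on D Sigma f -> Sigma zb ->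
    (forall y, Sigma y -> f zb <= f y + dotv c (y - zb)) ->
  exists u n, [/\ subdiff D f zb u, normal_cone Sigma zb n & u + c + n = 0].
Proof.
move=> cD cS SD cf lipf Szb fmin.
have [K [e [K0 e0 eD fK]]] := locally_lipschitz_ball lipf Szb.
have Dzb := SD _ Szb.
pose q (v : 'rV[R]_d) := K * `|v|.
pose C (w : 'rV[R]_d) (s : R) := exists (a b : R) y x,
  [/\ 0 <= a /\ 0 <= b, D y, Sigma x, w = b *: (x - zb) - a *: (y - zb) &
      a * (f y - f zb) + b * dotv c (x - zb) <= s].
have sq : sublinear q.
  split=> [u v|t u t0]; first by rewrite /q -mulrDr ler_pM2l// ler_normD.
  by rewrite /q normrZ gtr0_norm// mulrCA.
have cC : cone C.
  split=> [|w1 s1 w2 s2|t w s t0].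
  - by exists 0, 0, zb, zb; rewrite !scale0r !mul0r subrr addr0.
  - move=> [a1 [b1 [y1 [x1 [[a10 b10] Dy1 Sx1 -> s1E]]]]].
    move=> [a2 [b2 [y2 [x2 [[a20 b20] Dy2 Sx2 -> s2E]]]]].
    have [t [t0 t1 ta tE]] := conic_combination_weight a10 a20.
    have [r [r0 r1 rb rE]] := conic_combination_weight b10 b20.
    exists (a1 + a2), (b1 + b2), (y1 + t *: (y2 - y1)), (x1 + r *: (x2 - x1)).
    split; [by split; exact: addr_ge0|exact: convex_set_segment..| |].
      by rewrite tE rE opprD addrACA.
    rewrite -(dotvZr (b1 + b2)) rE dotvDr !dotvZr.
    have := ler_wpM2l (addr_ge0 a10 a20)
      (convex_function_segment cf Dy1 Dy2 t0 t1).
    by rewrite mulrDr (mulrA _ t) ta => h; lra.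
  - move=> [a [b [y [x [[a0 b0] Dy Sx -> sE]]]]].
    exists (t * a), (t * b), y, x; split=> //; first by rewrite !mulr_ge0// ltW.
      by rewrite scalerBr !scalerA.
    by rewrite -!mulrA -mulrDr ler_pM2l.
have qC w s : C w s -> 0 <= q w + s.
  move=> [a [b [y [x [[a0 b0] Dy Sx -> sE]]]]].
  apply: le_trans (lerD (lexx _) sE).
  near (0 : R)^'+ => t; have t0 : 0 < t by near: t; exact: nbhs_right_gt.
  have ta0 : 0 <= t * a by rewrite mulr_ge0// ltW.
  have tb0 : 0 <= t * b by rewrite mulr_ge0// ltW.
  have ta1 : t * a <= 1 by near: t; exact: near0_scaled_le1.
  have tb1 : t * b <= 1 by near: t; exact: near0_scaled_le1.
  have ye : ball zb e (zb + (t * a) *: (y - zb)).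
    by rewrite -scalerA; near: t; exact: near0_segment_ball.
  have xe : ball zb e (zb + (t * b) *: (x - zb)).
    by rewrite -scalerA; near: t; exact: near0_segment_ball.
  have h1 := convex_function_segment cf Dzb Dy ta0 ta1.
  have h2 := fmin _ (convex_set_segment cS Szb Sx tb0 tb1).
  move: h2; rewrite addrAC subrr add0r dotvZr => h2.
  have h3 := le_trans (ler_norm _) (fK _ _ xe ye).
  have dE : zb + (t * b) *: (x - zb) - (zb + (t * a) *: (y - zb)) =
      t *: (b *: (x - zb) - a *: (y - zb)).
    by rewrite -!scalerA opprD addrACA subrr add0r -scalerBr.
  move: h3; rewrite dE normrZ gtr0_norm// => h3.
  rewrite -(pmulr_rge0 _ t0) /q.
  by lra.
have [u [uq uC]] := sublinear_cone_separation sq cC qC.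
exists u, (- (u + c)); split; last by rewrite subrr.
- split=> // y Dy.
  have := uC (- (y - zb)) (f y - f zb); rewrite dotvNr opprK lerBrDl; apply.
  by exists 1, 0, y, zb; rewrite scale0r mul0r scale1r mul1r add0r addr0.
- split=> // x Sx; have := uC (x - zb) (dotv c (x - zb)).
  rewrite dotvNl dotvDl => h; suff: - dotv u (x - zb) <= dotv c (x - zb) by lra.
  apply: h; exists 0, 1, zb, x.
  by rewrite scale0r mul0r scale1r mul1r subr0 add0r.
Unshelve. all: by end_near. Qed.
End Convexity.

(** * A multiplier for an affine penalty *)

Section AffineMultiplier.
Context {R : realType} {d : nat}.

(** The condition on mu reads mu >= - F / G where G > 0 and mu <= F / - G where
    G < 0.  The lower bounds are at most 1 by hypothesis, and a lower bound at x
    never exceeds an upper bound at y: on the segment from x to y the affine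
    function G vanishes at a point, where F is nonnegative. *)
Lemma affine_multiplier (S : set 'rV[R]_d) (F G : 'rV[R]_d -> R) :
    convex_set S ->
    (forall x y t, S x -> S y -> 0 <= t -> t <= 1 ->
       F (x + t *: (y - x)) <= F x + t * (F y - F x)) ->
    (forall x y t, G (x + t *: (y - x)) = G x + t * (G y - G x)) ->
    (forall y, S y -> 0 <= F y + Num.max (G y) 0) ->
  exists mu, [/\ 0 <= mu, mu <= 1 & forall y, S y -> 0 <= F y + mu * G y].
Proof.
move=> cS cF aG FG0.
(* The element 0 makes A nonempty and the supremum nonnegative. *)
pose A := [set r | r = 0 \/ exists y, [/\ S y, 0 < G y & r = - F y / G y]].
have A0 : A 0 by left.
have A1 : ubound A 1.
  move=> _ [->//|[y [Sy Gy ->]]]; rewrite ler_pdivrMr// mul1r.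
  by have := FG0 y Sy; rewrite (max_l (ltW Gy)); lra.
have hA : has_sup A by split; [exists 0|exists 1].
exists (sup A); split=> [||y Sy]; first exact: ub_le_sup hA.2 _ A0.
  by apply: ge_sup => //; exists 0.
have [Gy|Gy|Gy] := ltgtP (G y) 0.
- have Gy' : 0 < - G y by rewrite oppr_gt0.
  suff : sup A <= F y / - G y by rewrite ler_pdivlMr//; lra.
  have Fy : 0 <= F y by have := FG0 y Sy; rewrite (max_r (ltW Gy)) addr0.
  apply: ge_sup; first by exists 0.
  move=> _ [->|[x [Sx Gx ->]]]; first by rewrite divr_ge0// ltW.
  have GG : 0 < G x - G y by lra.
  have t0 : 0 <= G x / (G x - G y) by rewrite divr_ge0 ?(ltW GG) ?(ltW Gx).
  have t1 : G x / (G x - G y) <= 1 by rewrite ler_pdivrMr// mul1r; lra.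
  have := FG0 _ (convex_set_segment cS Sx Sy t0 t1).
  have -> : G (x + (G x / (G x - G y)) *: (y - x)) = 0.
    by rewrite aG; field; rewrite gt_eqF.
  rewrite maxxx addr0 => /le_trans /(_ (cF _ _ _ Sx Sy t0 t1)).
  rewrite -(pmulr_rge0 _ GG).
  have -> : (G x - G y) * (F x + G x / (G x - G y) * (F y - F x)) =
      G x * F y - G y * F x by field; rewrite gt_eqF.
  by rewrite ler_pdivrMr// mulrAC ler_pdivlMr//; lra.
- suff : - F y / G y <= sup A by rewrite ler_pdivrMr//; lra.
  by apply: ub_le_sup hA.2 _ _; right; exists y.
- by have := FG0 y Sy; rewrite Gy maxxx mulr0.
Qed.

End AffineMultiplier.

(** * Smooth convex functions *)

Section SmoothConvex.
Context {R : realType} {d : nat}.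
Implicit Types (D Sigma : set 'rV[R]_d) (f : 'rV[R]_d -> R) (x y : 'rV[R]_d).

Lemma dotv_grad f x v : differentiable f x -> dotv (grad f x) v = 'D_v f x.
Proof.
move=> df; rewrite [v in RHS]row_sum_delta deriveE// linear_sum.
apply: eq_bigr => i _; rewrite linearZ mxE deriveE//=.
by rewrite mulrC.
Qed.

(** The one-sided difference quotients of a convex function along y - x are at
    most f y - f x. *)
Lemma grad_subdiff D f x : convex_function D f -> D x -> differentiable f x ->
  subdiff D f x (grad f x).
Proof.
move=> cf Dx df; split=> // y Dy; rewrite dotv_grad// -lerBrDl.
have fl : derivable f x (y - x) by exact: diff_derivable.
have {}fl : h^-1 *: (f (h *: (y - x) + x) - f x) @[h --> 0^'+] -->
    'D_(y - x) f x.
  apply: cvg_trans fl; apply: cvg_app => A A0.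
  have {}A0 : \forall h \near nbhs (0 : R), h != 0 -> A h := A0.
  suff : \forall h \near nbhs (0 : R), 0 < h -> A h by [].
  by apply: filterS A0 => h hA h0; apply: hA; rewrite gt_eqF.
apply: cvgr_to_le fl _.
near=> h; have h0 : 0 < h by near: h; exact: nbhs_right_gt.
have h1 : h <= 1 by near: h; exact: nbhs_right_le.
have := convex_function_segment cf Dx Dy (ltW h0) h1.
by rewrite [_ *: _]/= ler_pdivrMl// (addrC x); lra.
Unshelve. all: by end_near. Qed.

(** Convexity replaces integration along the segment.  The subgradient
    inequality at y gives the estimate with the constant L, and inserting the
    midpoint turns a constant C into C / 2 + L / 4, whose iterates starting at L
    are L / 2 * (1 + 2^-n) and tend to L / 2. *)
Lemma descent_lemma D Sigma (L : R) f x y :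
    convex_set Sigma -> Sigma `<=` D -> convex_function D f ->
    smooth_on D Sigma L f -> Sigma x -> Sigma y ->
  f y <= f x + dotv (grad f x) (y - x) + L / 2 * enorm (y - x) ^+ 2.
Proof.
move=> cS SD cf [L0 Sdf gradL] Sx Sy.
have H n x' y' : Sigma x' -> Sigma y' -> f y' <= f x' +
    dotv (grad f x') (y' - x') + L / 2 * (1 + 2^-1 ^+ n) * enorm (y' - x') ^+ 2.
  elim: n x' y' => [|n IH] u v Su Sv.
    have [_ /(_ u (SD _ Su))] := grad_subdiff cf (SD _ Sv) (Sdf _ Sv).2.
    have := cauchy_schwarz (grad f v - grad f u) (v - u).
    have := ler_wpM2r (enorm_ge0 (v - u)) (gradL _ _ Sv Su).
    by rewrite -(opprB v u) !dotvNr dotvDl dotvNl; lra.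
  have h0 : 0 <= 2^-1 :> R by lra.
  have h1 : 2^-1 <= 1 :> R by lra.
  pose m := u + 2^-1 *: (v - u).
  have Sm : Sigma m := convex_set_segment cS Su Sv h0 h1.
  have mu : m - u = 2^-1 *: (v - u) by rewrite addrAC subrr add0r.
  have vm : v - m = 2^-1 *: (v - u).
    by apply/rowP => i; rewrite !mxE; lra.
  have := IH _ _ Su Sm; have := IH _ _ Sm Sv; rewrite mu vm.
  have := cauchy_schwarz (grad f m - grad f u) (v - u).
  have := ler_wpM2r (enorm_ge0 (v - u)) (gradL _ _ Sm Su).
  rewrite mu !enormZ ger0_norm// (exprS _ n) !dotvE.
  set r := 2^-1 ^+ n; set E := enorm _.
  by lra.
have cvgH : L / 2 * (1 + 2^-1 ^+ n) * enorm (y - x) ^+ 2 @[n --> \oo] -->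
    L / 2 * (1 + 0) * enorm (y - x) ^+ 2.
  apply: cvgM; last exact: cvg_cst.
  apply: cvgM; first exact: cvg_cst.
  apply: cvgD; first exact: cvg_cst.
  by apply: cvg_expr; rewrite ger0_norm; lra.
rewrite addr0 mulr1 in cvgH; rewrite -lerBlDl.
by apply: cvgr_to_ge cvgH _; apply: nearW => n; rewrite lerBlDl; exact: H.
Qed.

End SmoothConvex.

(** * Limits of points and subgradients *)

Section Limits.
Context {R : realType} {d : nat}.
Implicit Types (D Sigma : set 'rV[R]_d) (f h : 'rV[R]_d -> R).

Lemma mx_norm_le_enorm (u : 'rV[R]_d) : `|u| <= enorm u.
Proof.
rewrite [leLHS]/Num.Def.normr /= mx_normrE.
apply: bigmax_le; first exact: enorm_ge0.
by move=> [i j] _ /=; rewrite (ord1 i); exact: coord_le_enorm.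
Qed.

Lemma cvg_dotv (T : Type) (F : set_system T) {FF : Filter F}
    (u v : T -> 'rV[R]_d) a b : u @ F --> a -> v @ F --> b ->
  dotv (u n) (v n) @[n --> F] --> dotv a b.
Proof.
move=> ua vb; apply: cvg_big => [|i _]; first exact: add_continuous.
have coord (w : T -> 'rV[R]_d) (c : 'rV[R]_d) : w @ F --> c ->
    w n ord0 i @[n --> F] --> c ord0 i.
  by move=> wc; exact: cvg_comp wc (@coord_continuous R 1 d ord0 i c).
by apply: cvgM; exact: coord.
Qed.

Lemma cvg_enorm (T : Type) (F : set_system T) {FF : Filter F}
    (u : T -> 'rV[R]_d) a : u @ F --> a -> enorm (u n) @[n --> F] --> enorm a.
Proof.
move=> ua.
exact: cvg_comp (cvg_dotv ua ua) (@sqrt_continuous R (dotv a a)).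
Qed.

Lemma enorm_cvg0 (T : Type) (F : set_system T) {FF : Filter F}
    (u : T -> 'rV[R]_d) a : enorm (u n - a) @[n --> F] --> 0 -> u @ F --> a.
Proof.
move=> /cvgr0Pnorm_lt ua; apply/cvgrPdist_lt => e /ua; apply: filterS => n.
rewrite ger0_norm ?enorm_ge0// distrC; apply: le_lt_trans.
exact: mx_norm_le_enorm.
Qed.

Lemma locally_lipschitz_continuous D Sigma f x :
  locally_lipschitz_on D Sigma f -> Sigma x -> f @ x --> f x.
Proof.
move=> lipf Sx; have [K [e [K0 e0 eD fK]]] := locally_lipschitz_ball lipf Sx.
suff H eps : 0 < eps -> \forall y \near x, `|f x - f y| < eps.
  by apply/(@cvgrPdist_lt _ _ _ (nbhs x)) => eps; exact: H.
move=> eps0; near=> y.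
have h := fK x y (ballxx _ e0); apply: le_lt_trans (h _) _.
  by near: y; exact: nbhsx_ballx.
rewrite -ltr_pdivlMl//; near: y.
by apply: cvgr_dist_lt => //; rewrite mulr_gt0// invr_gt0.
Unshelve. all: by end_near. Qed.

(** A subgradient v at y is tested against the step t v itself:
    t |v|^2 <= h (y + t v) - h y <= K t |v|. *)
Lemma subdiff_locally_bounded D Sigma h x :
    locally_lipschitz_on D Sigma h -> Sigma x ->
  exists K, \forall y \near x, forall v, subdiff D h y v -> `|v| <= K.
Proof.
move=> liph Sx; have [K [e [K0 e0 eD hK]]] := locally_lipschitz_ball liph Sx.
have e20 : 0 < e / 2 by rewrite divr_gt0.
exists K; near=> y.
have ye : ball x (e / 2) y by near: y; exact: nbhsx_ballx.
move=> v [_ hv]; have [->|v0] := eqVneq v 0; first by rewrite normr0 ltW.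
near (0 : R)^'+ => t; have t0 : 0 < t by near: t; exact: nbhs_right_gt.
have xye : ball x e (y + t *: v).
  rewrite (splitr e); apply: ball_triangle ye _.
  by near: t; exact: near0_segment_ball.
have xe : ball x e y by apply: le_ball ye; lra.
have := hv _ (eD _ xye); have := le_trans (ler_norm _) (hK _ _ xye xe).
rewrite addrAC subrr add0r normrZ gtr0_norm// dotvZr -enormE => h1 h2.
have vv : enorm v * enorm v <= K * `|v|.
  by rewrite -(ler_pM2l t0) -expr2; lra.
have v0' : 0 < enorm v.
  by apply: lt_le_trans (mx_norm_le_enorm v); rewrite normr_gt0.
apply: le_trans (mx_norm_le_enorm v) _; rewrite -(ler_pM2r v0').
by apply: le_trans vv _; rewrite ler_pM2l// mx_norm_le_enorm.
Unshelve. all: by end_near. Qed.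

Lemma subdiff_closed (F : set_system nat) {FF : ProperFilter F} D h
    (x v : nat -> 'rV[R]_d) a b :
    (forall n, subdiff D h (x n) (v n)) -> D a -> h @ a --> h a ->
    x @ F --> a -> v @ F --> b ->
  subdiff D h a b.
Proof.
move=> hv Da ha xa vb; split=> // y Dy.
have lim : h (x n) + dotv (v n) (y - x n) @[n --> F] --> h a + dotv b (y - a).
  apply: cvgD; first exact: cvg_comp xa ha.
  by apply: cvg_dotv => //; apply: cvgB => //; exact: cvg_cst.
by apply: cvgr_to_le lim _; apply: nearW => n; have [_] := hv n; exact.
Qed.

(** Plays the role of a convergent subsequence.  With an ultrafilter on the
    indices, every bounded sequence converges, so that no further extraction is
    necessary. *)
Lemma cluster_ultrafilter (T : topologicalType) (z : nat -> T) a :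
    cluster (z @ \oo) a ->
  exists U : set_system nat, [/\ UltraFilter U, \oo `<=` U & z @ U --> a].
Proof.
move=> za.
pose F := filter_from [set P : set nat * set T | \oo P.1 /\ nbhs a P.2]
  (fun P => P.1 `&` z @^-1` P.2).
have FF : ProperFilter F.
  apply: filter_from_proper.
    apply: filter_from_filter.
      by exists (setT, setT); split; exact: filterT.
    move=> [A B] [A' B'] [/= A1 B1] [/= A2 B2].
    exists (A `&` A', B `&` B'); first by split; exact: filterI.
    by move=> n [[An A'n] [Bn B'n]].
  move=> [A B] [/= A1 B1].
  have [|_ [[n An <-] Bn]] := za (z @` A) B _ B1; last by exists n.
  by apply: filterS A1 => n An; exists n.
have [U [UU FU]] := ultraFilterLemma FF; exists U; split=> //.
- move=> A A1; apply: FU; exists (A, setT); last by move=> n [].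
  by split; [exact: A1|exact: filterT].
- move=> B B1; apply: FU; exists (setT, B); last by move=> n [].
  by split; [exact: filterT|exact: B1].
Qed.

Lemma bounded_ultrafilter_cvg (U : set_system nat) {UU : UltraFilter U}
    (v : nat -> 'rV[R]_d) K : (\forall n \near U, `|v n| <= K) ->
  exists b : 'rV[R]_d, v @ U --> b.
Proof.
move=> vK; have cB : compact (closed_ball_ Num.Def.normr (0 : 'rV[R]_d) K).
  apply: bounded_closed_compact; last exact: closed_closed_ball_.
  exists K; split=> [|M KM x]; first exact: num_real.
  by rewrite /closed_ball_ /= sub0r normrN => /le_trans; apply; exact: ltW.
have [|b [_ vb]] := cB (v @ U) _.
  by apply: filterS vK => n; rewrite /closed_ball_ /= sub0r normrN.
exists b => B Bb.
have [//|UB] := in_ultra_setVsetC (v @^-1` B) UU.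
by have [x []] := vb (~` B) B UB Bb.
Qed.

End Limits.

(** * The convex subproblem *)

Section Subproblem.
Context {R : realType} {d : nat}.
Variables (D Sigma : set 'rV[R]_d) (g0 h0 g1 h1 : 'rV[R]_d -> R).
Local Notation phi := (phi_hat g0 h0 g1 h1).
Implicit Types (w x y xi : 'rV[R]_d) (beta rho t : R).

Lemma enorm_segment w x y t :
  enorm (x + t *: (y - x) - w) ^+ 2 = enorm (x - w) ^+ 2 +
    t * (enorm (y - w) ^+ 2 - enorm (x - w) ^+ 2) -
    t * (1 - t) * enorm (y - x) ^+ 2.
Proof.
have -> : x + t *: (y - x) - w = (x - w) + t *: (y - x) by rewrite addrAC.
have -> : y - x = (y - w) - (x - w) by rewrite opprB addrA subrK.
by move: (x - w) (y - w) => a b; rewrite !enormE !dotvE (dotvC b a); ring.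
Qed.

Lemma lin_viol_segment w xi x y t : 0 <= t -> t <= 1 ->
  lin_viol g1 h1 w xi (x + t *: (y - x)) <=
  lin_viol g1 h1 w xi x + t * (lin_viol g1 h1 w xi y - lin_viol g1 h1 w xi x).
Proof.
move=> t0 t1; rewrite /lin_viol.
pose a p := g1 w + dotv (grad g1 w) (p - w) - h1 w - dotv xi (p - w).
rewrite -!/(a _).
have -> : a (x + t *: (y - x)) = (1 - t) * a x + t * a y.
  by rewrite /a !dotvE; ring.
have t1' : 0 <= 1 - t by lra.
have -> (p q : R) : p + t * (q - p) = (1 - t) * p + t * q by ring.
rewrite ge_max; apply/andP; split.
  by rewrite lerD// ler_wpM2l// le_max lexx.
by rewrite addr_ge0// mulr_ge0// le_max lexx orbT.
Qed.

Lemma phi_hat_segment w xi0 xi1 beta rho x y t :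
    convex_function D g0 -> 0 <= beta -> D x -> D y -> 0 <= t -> t <= 1 ->
  phi w xi0 xi1 beta rho (x + t *: (y - x)) <=
    phi w xi0 xi1 beta rho x +
    t * (phi w xi0 xi1 beta rho y - phi w xi0 xi1 beta rho x) -
    rho / 2 * (t * (1 - t)) * enorm (y - x) ^+ 2.
Proof.
move=> cg0 b0 Dx Dy t0 t1; rewrite /phi_hat enorm_segment.
have h := convex_function_segment cg0 Dx Dy t0 t1.
have := ler_wpM2l b0 (lin_viol_segment w xi1 x y t0 t1).
have -> : dotv xi0 (x + t *: (y - x) - w) =
    dotv xi0 (x - w) + t * (dotv xi0 (y - w) - dotv xi0 (x - w)).
  by rewrite !dotvE; ring.
by move: h; lra.
Qed.

(** The distance to 0 need not be attained, so the inequality is obtained with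
    an error e and then e tends to 0.  The quadratic gain comes from testing the
    subgradient at x + e (y - x) instead of y; taking the same e for both
    purposes leaves a single limit. *)
Lemma residual_variational_inequality w xi0 xi1 beta rho (r : R) x y :
    convex_set Sigma -> Sigma `<=` D -> convex_function D g0 -> 0 <= beta ->
    (stationarity_residual D Sigma g0 h0 g1 h1 w xi0 xi1 beta rho x
       <= r%:E)%E ->
    Sigma y ->
  phi w xi0 xi1 beta rho x - r * enorm (y - x) +
    rho / 2 * enorm (y - x) ^+ 2 <= phi w xi0 xi1 beta rho y.
Proof.
move=> cS SD cg0 b0 res Sy.
pose psi := phi w xi0 xi1 beta rho; rewrite -!/(psi _).
set N := enorm (y - x).
have approx e : 0 < e -> e <= 1 ->
    psi x - (r + e) * N + rho / 2 * (1 - e) * N ^+ 2 <= psi y.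
  move=> e0 e1; have : (stationarity_residual D Sigma g0 h0 g1 h1 w xi0 xi1
      beta rho x < (r + e)%:E)%E.
    by apply: le_lt_trans res _; rewrite lte_fin ltrDl.
  move=> /ereal_inf_lt[_ [_ [u [Dx usub] [n [Sx nsub] <-]] <-]].
  rewrite lte_fin sub0r enormN => un.
  have := cauchy_schwarz (- (u + n)) (y - x).
  have := ler_wpM2r (enorm_ge0 (y - x)) (ltW un).
  rewrite enormN dotvNl dotvDl -/N => un' cs.
  have Sm := convex_set_segment cS Sx Sy (ltW e0) e1.
  have seg := phi_hat_segment w xi0 xi1 rho cg0 b0 Dx (SD _ Sy) (ltW e0) e1.
  have := le_trans (usub _ (SD _ Sm)) seg.
  have -> : x + e *: (y - x) - x = e *: (y - x) by rewrite addrAC subrr add0r.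
  rewrite dotvZr -!/(psi _) -/N => us.
  have nS := nsub _ Sy.
  have {}us : e * (dotv u (y - x)) <=
      e * (psi y - psi x - rho / 2 * (1 - e) * N ^+ 2) by lra.
  by rewrite ler_pM2l// in us; lra.
rewrite leNgt; apply/negP => lt_psi.
pose B := psi x - r * N + rho / 2 * N ^+ 2 - psi y.
have B0 : 0 < B by rewrite /B; lra.
near (0 : R)^'+ => e.
have e0 : 0 < e by near: e; exact: nbhs_right_gt.
have e1 : e <= 1 by near: e; exact: nbhs_right_le.
have : e * (2 * (N + rho / 2 * N ^+ 2) / B) <= 1.
  by near: e; exact: near0_scaled_le1.
rewrite mulrA ler_pdivrMr// mul1r.
by have := approx e e0 e1; rewrite /B; lra.
Unshelve. all: by end_near. Qed.

Lemma phi_hat_self w xi0 xi1 beta rho :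
  phi_hat g0 h0 g1 h1 w xi0 xi1 beta rho w =
  g0 w - h0 w + beta * Num.max (g1 w - h1 w) 0.
Proof.
by rewrite /phi_hat /lin_viol subrr !dotv0r enorm0 expr0n mulr0 !subr0 !addr0.
Qed.

(** The concave parts are linearized from above by their subgradients, and the
    linearization of g1 falls below g1 by at most L / 2 * |x - w|^2, a loss that
    is multiplied by beta. *)
Lemma phi_hat_majorizes w xi0 xi1 beta rho (L : R) x :
    convex_set Sigma -> Sigma `<=` D -> convex_function D g1 ->
    smooth_on D Sigma L g1 -> 0 <= beta ->
    subdiff D h0 w xi0 -> subdiff D h1 w xi1 -> Sigma w -> Sigma x ->
  g0 x - h0 x + beta * Num.max (g1 x - h1 x) 0 +
    (rho - beta * L) / 2 * enorm (x - w) ^+ 2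
  <= phi_hat g0 h0 g1 h1 w xi0 xi1 beta rho x.
Proof.
move=> cS SD cg1 smg1 b0 [_ s0] [_ s1] Sw Sx.
have := s0 _ (SD _ Sx); have := s1 _ (SD _ Sx).
have := descent_lemma cS SD cg1 smg1 Sw Sx; have [L0 _ _] := smg1.
rewrite /phi_hat /lin_viol; set A := g1 w + _ - _ - _ => descent h1x h0x.
have viol : Num.max (g1 x - h1 x) 0 - L / 2 * enorm (x - w) ^+ 2 <= Num.max A 0.
  have q0 : 0 <= L / 2 * enorm (x - w) ^+ 2.
    by rewrite mulr_ge0// ?sqr_ge0// divr_ge0.
  rewrite lerBlDr ge_max; apply/andP; split; last first.
    by rewrite addr_ge0// le_max lexx orbT.
  by rewrite -lerBlDr le_max; apply/orP; left; rewrite /A; lra.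
by have := ler_wpM2l b0 viol; lra.
Qed.

End Subproblem.

(** * Asymptotics of the iteration *)

Section Algorithm.
Context {R : realType} {d : nat}.

Lemma telescoping_cvg0 (P s : R^nat) (a m : R) (K : nat) : 0 < a ->
    (forall k, 0 <= s k) -> (forall k, (K <= k)%N -> m <= P k) ->
    (forall k, (K <= k)%N -> P k.+1 + a * s k <= P k) ->
  s @ \oo --> 0.
Proof.
move=> a0 s0 mP dP.
have cP : cvgn P.
  have : cvgn [sequence P (n + K)%N]_n.
    apply: nonincreasing_is_cvgn.
      apply/nonincreasing_seqP => n /=; rewrite addSn.
      apply: le_trans (dP _ (leq_addl _ _)); rewrite lerDl mulr_ge0//.
      exact: ltW.
    by exists m => _ [n _ <-]; apply: mP; exact: leq_addl.
  by move=> /cvg_ex[l]; rewrite cvg_shiftn => Pl; apply/cvg_ex; exists l.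
have dif : (P k - P k.+1) / a @[k --> \oo] --> 0.
  rewrite -(mul0r a^-1) -(subrr (lim (P @ \oo))).
  apply: cvgM; last exact: cvg_cst.
  by apply: cvgB => //; rewrite cvg_shiftS.
apply: squeeze_cvgr (cvg_cst 0) dif; exists K => // k /= Kk.
by rewrite s0 ler_pdivlMr// lerBrDl mulrC; exact: dP.
Qed.

Variables (D Sigma : set 'rV[R]_d) (g0 h0 g1 h1 : 'rV[R]_d -> R).
Variables (L delta_beta sigma : R) (zeta : R^nat).
Variables (z xi0 xi1 : nat -> 'rV[R]_d) (beta rho : R^nat).
Hypotheses (Sigma_convex : convex_set Sigma) (Sigma_sub_D : Sigma `<=` D).
Hypothesis g0_convex : convex_function D g0.
Hypothesis g1_convex : convex_function D g1.
Hypothesis g1_smooth : smooth_on D Sigma L g1.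
Hypothesis f0_bounded_below : has_lbound [set g0 x - h0 x | x in Sigma].
Hypothesis algo : is_iPL_DCA D Sigma g0 h0 g1 h1 L delta_beta sigma zeta
  z xi0 xi1 beta rho.
Hypothesis beta_bounded : bounded_fun beta.

Let step k := enorm (z k.+1 - z k).
Let viol k := lin_viol g1 h1 (z k) (xi1 k) (z k.+1).
Let residual k := stationarity_residual D Sigma g0 h0 g1 h1
  (z k) (xi0 k) (xi1 k) (beta k) (rho k) (z k.+1).

Let step_ge0 k : 0 <= step k. Proof. exact: enorm_ge0. Qed.

Let viol_ge0 k : 0 <= viol k. Proof. by rewrite le_max lexx orbT. Qed.

(** The exact penalty function of the constrained problem. *)
Definition merit (b : R) x := g0 x - h0 x + b * Num.max (g1 x - h1 x) 0.

(** A common bound for the two stopping criteria, chosen so that its square is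
    the sum of the squares of their right-hand sides. *)
Definition tolerance k :=
  Num.sqrt (zeta k ^+ 2 + sigma ^+ 2 / 2 * enorm (z k - z k.-1) ^+ 2).

Lemma beta_nondecreasing : nondecreasing_seq beta.
Proof.
apply/nondecreasing_seqP => k; rewrite (betaE algo); case: ifP => // _.
by rewrite lerDl ltW// (delta_beta_gt0 algo).
Qed.

Lemma beta_gt0 k : 0 < beta k.
Proof.
by apply: lt_le_trans (beta0_gt0 algo) _; apply: beta_nondecreasing.
Qed.

(** A bounded nondecreasing sequence has increments tending to 0, eventually
    below delta_beta; the test that triggers an increment then fails. *)
Lemma beta_eventually_constant : exists K, forall k, (K <= k)%N ->
  beta k = beta K /\
  ((step k)%:E^-1 <= maxe (beta k)%:E (viol k)%:E^-1)%E.
Proof.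
have cb : cvgn beta.
  apply: nondecreasing_is_cvgn; first exact: beta_nondecreasing.
  have [M [_ Mb]] := beta_bounded; exists (M + 1) => _ [k _ <-].
  apply: le_trans (ler_norm _) _; apply: Mb => //; lra.
have : beta k.+1 - beta k @[k --> \oo] --> 0.
  by rewrite -(subrr (lim (beta @ \oo))); apply: cvgB => //; rewrite cvg_shiftS.
move=> /cvgr_lt/(_ _ (delta_beta_gt0 algo))[K _ HK].
have Kcond k : (K <= k)%N -> beta k.+1 = beta k /\
    ((step k)%:E^-1 <= maxe (beta k)%:E (viol k)%:E^-1)%E.
  move=> /HK /=; rewrite (betaE algo k) -/(viol k) -/(step k).
  case: ifPn => [_|]; first by rewrite addrC addKr ltxx.
  by rewrite -leNgt.
exists K => k Kk; split; last by case: (Kcond _ Kk).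
rewrite -(subnK Kk); elim: (k - K)%N => // n IH.
by rewrite addSn (Kcond _ _).1// leq_addl.
Qed.

Lemma residual_le_tolerance k : (0 < k)%N -> (residual k <= (tolerance k)%:E)%E.
Proof.
move=> k0; have := inexact algo k; rewrite -/(residual k).
have s0 := ltW (sigma_gt0 algo).
case=> [|/(_ k0)] /le_trans; apply; rewrite lee_fin.
  rewrite -[leLHS]ger0_norm ?(zeta_ge0 algo)// -sqrtr_sqr ler_wsqrtr//.
  by rewrite lerDl mulr_ge0// ?sqr_ge0// divr_ge0// sqr_ge0.
rewrite -[leLHS]ger0_norm; last by rewrite !mulr_ge0 ?enorm_ge0// invr_ge0.
rewrite -sqrtr_sqr ler_wsqrtr// !exprMn sqr_sqrtr//.
rewrite (_ : 2 * _ * _ * _ = sigma ^+ 2 / 2 * enorm (z k - z k.-1) ^+ 2).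
  by rewrite lerDr sqr_ge0.
by field.
Qed.

(** At the new point the model lies above the penalty function and, by the
    stopping criterion, below the value of the penalty function at the old
    point, up to the tolerance.  The coefficients of the quadratic terms in these
    two bounds add up to rho - beta L / 2 = sigma. *)
Lemma merit_decrease k : (0 < k)%N ->
  merit (beta k) (z k.+1) + sigma * step k ^+ 2 - tolerance k * step k <=
  merit (beta k) (z k).
Proof.
move=> k0; have b0 := ltW (beta_gt0 k).
have Szk := z_in algo k; have Szk1 := z_in algo k.+1.
have := residual_variational_inequality Sigma_convex Sigma_sub_D g0_convex b0
  (residual_le_tolerance k0) Szk.
have := phi_hat_majorizes g0 (rho k) Sigma_convex Sigma_sub_D g1_convex
  g1_smooth b0 (xi0_subdiff algo k) (xi1_subdiff algo k) Szk Szk1.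
rewrite phi_hat_self -(opprB (z k.+1) (z k)) enormN -/(step k).
rewrite (rhoE algo) /merit.
set A := phi_hat _ _ _ _ _ _ _ _ _ _; lra.
Qed.

(** By Young's inequality the error tolerance * step is at most half of the
    decrease sigma * step^2 plus tolerance^2 / (2 sigma), which is sigma / 4 times
    the square of the previous step plus a summable term.  This is where the
    factor sqrt 2 / 2 of the second criterion matters: sigma / 4 < sigma / 2, so
    that P is a Lyapunov function. *)
Lemma step_cvg0 : step @ \oo --> 0.
Proof.
have [K HK] := beta_eventually_constant.
have s0 := sigma_gt0 algo.
have [m mf] := f0_bounded_below.
pose S := series (fun k => zeta k ^+ 2).
have SM k : S k <= lim (S @ \oo).
  apply: nondecreasing_cvgn_le; last exact: (zeta_summable algo).
  by apply/nondecreasing_seqP => n; rewrite /S seriesSr lerDl sqr_ge0.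
pose P k := merit (beta K) (z k) + sigma / 4 * enorm (z k - z k.-1) ^+ 2
  - S k / (2 * sigma).
suff : step k ^+ 2 @[k --> \oo] --> 0.
  move=> s2; have := cvg_comp _ _ s2 (@sqrt_continuous R 0); rewrite sqrtr0.
  by under eq_cvg do rewrite /= sqrtr_sqr ger0_norm//.
apply: (@telescoping_cvg0 P _ (sigma / 4) (m - lim (S @ \oo) / (2 * sigma))
  K.+1).
- by rewrite divr_gt0.
- by move=> k; exact: sqr_ge0.
- move=> k _; rewrite /P lerB//; last first.
    by rewrite ler_pM2r// invr_gt0 mulr_gt0.
  have mz : m <= g0 (z k) - h0 (z k).
    by apply: mf; exists (z k) => //; exact: (z_in algo).
  rewrite -addrA (le_trans mz)// lerDl addr_ge0// mulr_ge0// ?sqr_ge0//.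
  - exact: ltW (beta_gt0 K).
  - by rewrite le_max lexx orbT.
  - by rewrite divr_ge0// ltW.
- move=> k Kk; have := merit_decrease (leq_trans (ltn0Sn K) Kk).
  rewrite (HK _ (ltnW Kk)).1 /P /S seriesSr /= -/(step k).
  have tol2 : tolerance k ^+ 2 =
      zeta k ^+ 2 + sigma ^+ 2 / 2 * enorm (z k - z k.-1) ^+ 2.
    rewrite sqr_sqrtr// addr_ge0 ?sqr_ge0// mulr_ge0 ?sqr_ge0//.
    by rewrite divr_ge0// sqr_ge0.
  have young : tolerance k * step k <= sigma / 2 * step k ^+ 2 +
      (zeta k ^+ 2 + sigma ^+ 2 / 2 * enorm (z k - z k.-1) ^+ 2) / (2 * sigma).
    rewrite -tol2 -subr_ge0.
    rewrite (_ : _ - _ = (sigma * step k - tolerance k) ^+ 2 / (2 * sigma)).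
      by rewrite divr_ge0 ?sqr_ge0// mulr_ge0// ltW.
    by field; rewrite gt_eqF.
  rewrite mulrDl in young.
  have e : sigma ^+ 2 / 2 * enorm (z k - z k.-1) ^+ 2 / (2 * sigma) =
      sigma / 4 * enorm (z k - z k.-1) ^+ 2 by field; rewrite gt_eqF.
  by rewrite e in young; rewrite mulrDl; lra.
Qed.

Lemma tolerance_cvg0 : tolerance @ \oo --> 0.
Proof.
have sq0 : zeta k ^+ 2 + sigma ^+ 2 / 2 * enorm (z k - z k.-1) ^+ 2
    @[k --> \oo] --> 0.
  rewrite -(addr0 0); apply: cvgD.
    exact: cvg_series_cvg_0 (zeta_summable algo).
  rewrite -(mulr0 (sigma ^+ 2 / 2)); apply: cvgM; first exact: cvg_cst.
  have := cvgM (FF := _) step_cvg0 step_cvg0; rewrite mulr0 => step2.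
  by rewrite -cvg_shiftS; exact: step2.
have := cvg_comp _ _ sq0 (@sqrt_continuous R 0).
by rewrite sqrtr0; exact.
Qed.

(** Since beta is bounded and the step tends to 0, only the violation can be
    responsible for the failure of the test max(beta, 1 / viol) < 1 / step. *)
Lemma viol_le_step : \forall k \near \oo, viol k <= step k.
Proof.
have [K HK] := beta_eventually_constant.
have bK : 0 < (beta K)^-1 by rewrite invr_gt0 beta_gt0.
have /cvgr_lt/(_ _ bK)[K' _ HK'] := step_cvg0.
exists (maxn K K') => // k /=; rewrite geq_max.
move=> /andP[/HK[bk cond] /HK' stepk].
have [v0|v0] := eqVneq (viol k) 0; first by rewrite v0; exact: step_ge0.
have v0' : 0 < viol k by rewrite lt0r v0; exact: viol_ge0.
move: cond; rewrite (inver (viol k)) (negbTE v0) inver.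
case: eqP => [|/eqP s0]; first by rewrite -EFin_max leye_eq.
have s0' : 0 < step k by rewrite lt0r s0; exact: step_ge0.
rewrite -EFin_max lee_fin le_max bk => /orP[h|].
  by move: stepk; rewrite /= ltNge invf_ple ?posrE ?beta_gt0 ?h.
by rewrite lef_pV2.
Qed.

End Algorithm.

(** * Stationarity of accumulation points *)

(** The multiplier is b mu, with mu from the affine multiplier lemma applied to
    F and to b times the linearized constraint, both centered at zb.  At zb the
    inequality 0 <= F + mu G becomes 0 <= b mu (g1 zb - h1 zb), and feasibility
    gives the converse. *)
Lemma linearized_minimizer_KKT (R : realType) (d : nat)
    (D Sigma : set 'rV[R]_d) (g0 h0 g1 h1 : 'rV[R]_d -> R) (L b : R)
    (zb v0 v1 : 'rV[R]_d) :
    convex_set D -> convex_set Sigma -> Sigma `<=` D ->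
    convex_function D g0 -> convex_function D g1 ->
    locally_lipschitz_on D Sigma g0 -> smooth_on D Sigma L g1 ->
    0 < b -> Sigma zb -> g1 zb - h1 zb <= 0 ->
    subdiff D h0 zb v0 -> subdiff D h1 zb v1 ->
    (forall y, Sigma y ->
       g0 zb <= g0 y - dotv v0 (y - zb) + b * lin_viol g1 h1 zb v1 y) ->
  is_KKT D Sigma g0 h0 g1 h1 zb.
Proof.
move=> cD cS SD cg0 cg1 lipg0 [_ smg1 _] b0 Szb f1zb hv0 hv1 zbmin.
pose a := grad g1 zb - v1.
pose F y := g0 y - g0 zb - dotv v0 (y - zb).
pose G y := b * (g1 zb - h1 zb + dotv a (y - zb)).
have FG0 y : Sigma y -> 0 <= F y + Num.max (G y) 0.
  move=> /zbmin; have -> : Num.max (G y) 0 = b * lin_viol g1 h1 zb v1 y.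
    rewrite /lin_viol maxr_pMr ?ltW// mulr0 /G /a dotvDl dotvNl.
    by congr (Num.max (b * _) 0); ring.
  by rewrite /F; lra.
have cF x y t : Sigma x -> Sigma y -> 0 <= t -> t <= 1 ->
    F (x + t *: (y - x)) <= F x + t * (F y - F x).
  move=> /SD Dx /SD Dy t0 t1.
  have := convex_function_segment cg0 Dx Dy t0 t1.
  by rewrite /F !dotvE; lra.
have aG x y t : G (x + t *: (y - x)) = G x + t * (G y - G x).
  by rewrite /G !dotvE; ring.
have [mu [mu0 mu1 FmuG]] := affine_multiplier cS cF aG FG0.
have lambda0 : 0 <= b * mu by rewrite mulr_ge0// ltW.
have compl : (g1 zb - h1 zb) * (b * mu) = 0.
  apply/eqP; rewrite eq_le mulr_le0_ge0//=.
  by have := FmuG _ Szb; rewrite /F /G !subrr !dotv0r; lra.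
have gmin y : Sigma y ->
    g0 zb <= g0 y + dotv (- v0 + (b * mu) *: a) (y - zb).
  by move=> /FmuG; rewrite /F /G (dotvDl (- v0)) (dotvNl v0) dotvZl; lra.
have [u [n [gu nn un0]]] :=
  subdiff_normal_cone_sum cD cS SD cg0 lipg0 Szb gmin.
split=> //; exists (b * mu); split=> //.
exists u, v0, (grad g1 zb), v1, n; split=> //.
  by split=> //; apply: grad_subdiff (SD _ Szb) (smg1 _ Szb).2.
by rewrite -un0 addrA.
Qed.

Lemma cvg_lin_viol (R : realType) (d : nat) (g1 h1 : 'rV[R]_d -> R)
    (F : set_system nat) {FF : Filter F} (w xi y : nat -> 'rV[R]_d)
    (w' xi' y' : 'rV[R]_d) :
    g1 @ w' --> g1 w' -> h1 @ w' --> h1 w' ->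
    grad g1 (w n) @[n --> F] --> grad g1 w' ->
    w @ F --> w' -> xi @ F --> xi' -> y @ F --> y' ->
  lin_viol g1 h1 (w n) (xi n) (y n) @[n --> F] --> lin_viol g1 h1 w' xi' y'.
Proof.
move=> cg1 ch1 cgrad ww xixi yy.
have cmax : {for g1 w' + dotv (grad g1 w') (y' - w') - h1 w' -
    dotv xi' (y' - w'), continuous (fun r : R => Num.max r 0)}.
  by apply: continuous_max => //; exact: cvg_cst.
have yw : y n - w n @[n --> F] --> y' - w' by exact: cvgB.
suff lim : g1 (w n) + dotv (grad g1 (w n)) (y n - w n) - h1 (w n)
    - dotv (xi n) (y n - w n) @[n --> F] -->
    g1 w' + dotv (grad g1 w') (y' - w') - h1 w' - dotv xi' (y' - w').
  exact: cvg_comp lim cmax.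
apply: cvgB; last exact: cvg_dotv.
apply: cvgB; last exact: cvg_comp ww ch1.
by apply: cvgD; [exact: cvg_comp ww cg1|exact: cvg_dotv].
Qed.

Theorem theorem2 (R : realType) (d : nat) (D Sigma : set 'rV[R]_d)
    (g0 h0 g1 h1 : 'rV[R]_d -> R) (L delta_beta sigma : R) (zeta : R^nat)
    (z xi0 xi1 : nat -> 'rV[R]_d) (beta rho : R^nat)
    (Sigma_closed : closed Sigma) (Sigma_convex : convex_set Sigma)
    (D_convex : convex_set D) (Sigma_sub_D : Sigma `<=` D)
    (g0_convex : convex_function D g0) (h0_convex : convex_function D h0)
    (g1_convex : convex_function D g1) (h1_convex : convex_function D h1)
    (g1_smooth : smooth_on D Sigma L g1)
    (f0_bounded_below : has_lbound [set g0 x - h0 x | x in Sigma])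
    (algo : is_iPL_DCA D Sigma g0 h0 g1 h1 L delta_beta sigma zeta
              z xi0 xi1 beta rho)
    (z_bounded : bounded_fun z) (beta_bounded : bounded_fun beta)
    (g0_lip : locally_lipschitz_on D Sigma g0)
    (h1_lip : locally_lipschitz_on D Sigma h1)
    (h0_lip : locally_lipschitz_on D Sigma h0) :
  forall zbar : 'rV[R]_d, cluster (z @ \oo) zbar ->
    is_KKT D Sigma g0 h0 g1 h1 zbar.
Proof.
move=> zb /cluster_ultrafilter[U [UU Uoo zU]].
have toU (f : R^nat) (l : R) : f @ \oo --> l -> f @ U --> l.
  exact: cvg_trans (cvg_app f Uoo).
have Szb : Sigma zb.
  by apply: (closed_cvg _ Sigma_closed _ _ zU); apply: nearW; exact: z_in algo.
have Dzb := Sigma_sub_D _ Szb.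
have [L0 Sdg1 gradL] := g1_smooth.
have cg0 := locally_lipschitz_continuous g0_lip Szb.
have ch0 := locally_lipschitz_continuous h0_lip Szb.
have ch1 := locally_lipschitz_continuous h1_lip Szb.
have cg1 : g1 @ zb --> g1 zb.
  exact: differentiable_continuous (Sdg1 _ Szb).2.
have stepU : enorm (z n.+1 - z n) @[n --> U] --> 0.
  by apply: toU; apply: step_cvg0 algo _.
have dzU : z n.+1 - z n @[n --> U] --> (0 : 'rV[R]_d).
  by apply: enorm_cvg0; under eq_cvg do rewrite subr0.
have z1U : z n.+1 @[n --> U] --> zb.
  have := cvgD zU dzU; rewrite addr0.
  under eq_cvg do rewrite /= addrC subrK.
  exact.
have tolU := toU _ _ (tolerance_cvg0 Sigma_convex Sigma_sub_D g0_convex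
  g1_convex g1_smooth f0_bounded_below algo beta_bounded).
have gradU : grad g1 (z n) @[n --> U] --> grad g1 zb.
  apply: enorm_cvg0.
  have : L * enorm (z n - zb) @[n --> U] --> 0.
    rewrite -(mulr0 L) -(@enorm0 R d) -(subrr zb).
    apply: cvgM; first exact: cvg_cst.
    by apply: cvg_enorm; apply: cvgB => //; exact: cvg_cst.
  apply: squeeze_cvgr (cvg_cst 0); apply: nearW => n.
  by rewrite enorm_ge0 gradL//; exact: z_in algo n.
have subgradU h xi : locally_lipschitz_on D Sigma h ->
    (forall n, subdiff D h (z n) (xi n)) ->
    exists2 v : 'rV[R]_d, xi @ U --> v & subdiff D h zb v.
  move=> liph hxi; have [K HK] := subdiff_locally_bounded liph Szb.
  have [v xiU] : exists v : 'rV[R]_d, xi @ U --> v.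
    apply: (@bounded_ultrafilter_cvg _ _ U UU xi K).
    have zK : \forall n \near U, forall v, subdiff D h (z n) v -> `|v| <= K.
      exact: zU HK.
    by apply: filterS zK => n; apply; exact: hxi.
  exists v => //; apply: (subdiff_closed hxi Dzb _ zU xiU).
  exact: locally_lipschitz_continuous liph Szb.
have [v0 xi0U hv0] := subgradU _ _ h0_lip (xi0_subdiff algo).
have [v1 xi1U hv1] := subgradU _ _ h1_lip (xi1_subdiff algo).
have [K HK] := beta_eventually_constant algo beta_bounded.
have b0 : 0 < beta K := beta_gt0 algo K.
have f1zb : g1 zb - h1 zb <= 0.
  have viol_le : lin_viol g1 h1 zb v1 zb <= 0.
    apply: (ler_cvg_to _ stepU); first exact: cvg_lin_viol zU xi1U z1U.
    apply: Uoo; exact: viol_le_step Sigma_convex Sigma_sub_D g0_convex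
      g1_convex g1_smooth f0_bounded_below algo beta_bounded.
  move: viol_le; rewrite /lin_viol subrr !dotv0r addr0 subr0 ge_max.
  by case/andP.
apply: (linearized_minimizer_KKT D_convex Sigma_convex Sigma_sub_D g0_convex
  g1_convex g0_lip g1_smooth b0 Szb f1zb hv0 hv1) => y Sy.
pose r := beta K * L / 2 + sigma.
have r0 : 0 <= r.
  by rewrite addr_ge0 ?(ltW (sigma_gt0 algo))// divr_ge0// mulr_ge0// ltW.
(* The subproblem inequality at y, with the nonnegative proximal and penalty
   terms at the new iterate dropped; both tend to 0. *)
have VI n : (K < n)%N ->
    g0 (z n.+1) - dotv (xi0 n) (z n.+1 - z n)
      - tolerance sigma zeta z n * enorm (y - z n.+1)
      + r / 2 * enorm (y - z n.+1) ^+ 2 <=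
    g0 y - dotv (xi0 n) (y - z n) + r / 2 * enorm (y - z n) ^+ 2
      + beta K * lin_viol g1 h1 (z n) (xi1 n) y.
  move=> Kn; have n0 : (0 < n)%N := leq_ltn_trans (leq0n K) Kn.
  have bn := (HK _ (ltnW Kn)).1.
  have := residual_variational_inequality Sigma_convex Sigma_sub_D g0_convex
    (ltW (beta_gt0 algo n)) (residual_le_tolerance algo n0) Sy.
  rewrite (rhoE algo) bn -/r /phi_hat.
  have : 0 <= beta K * lin_viol g1 h1 (z n) (xi1 n) (z n.+1).
    by rewrite mulr_ge0 ?(ltW b0)// le_max lexx orbT.
  have : 0 <= r / 2 * enorm (z n.+1 - z n) ^+ 2.
    by rewrite mulr_ge0 ?sqr_ge0// divr_ge0.
  lra.
have yU (w : nat -> 'rV[R]_d) : w @ U --> zb -> y - w n @[n --> U] --> y - zb.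
  by move=> wU; apply: cvgB => //; exact: cvg_cst.
have sqU (w : nat -> 'rV[R]_d) : w @ U --> zb ->
    r / 2 * enorm (y - w n) ^+ 2 @[n --> U] --> r / 2 * enorm (y - zb) ^+ 2.
  move=> /yU wU; apply: cvgM; first exact: cvg_cst.
  exact: cvg_comp (cvg_enorm wU) (@exprn_continuous R 2 _).
have lhsU : g0 (z n.+1) - dotv (xi0 n) (z n.+1 - z n)
      - tolerance sigma zeta z n * enorm (y - z n.+1)
      + r / 2 * enorm (y - z n.+1) ^+ 2 @[n --> U] -->
    g0 zb - dotv v0 0 - 0 * enorm (y - zb) + r / 2 * enorm (y - zb) ^+ 2.
  apply: cvgD; last exact: sqU.
  apply: cvgB; last by apply: cvgM => //; apply: cvg_enorm; exact: yU.
  by apply: cvgB; [exact: cvg_comp z1U cg0|exact: cvg_dotv].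
have rhsU : g0 y - dotv (xi0 n) (y - z n) + r / 2 * enorm (y - z n) ^+ 2
      + beta K * lin_viol g1 h1 (z n) (xi1 n) y @[n --> U] -->
    g0 y - dotv v0 (y - zb) + r / 2 * enorm (y - zb) ^+ 2
      + beta K * lin_viol g1 h1 zb v1 y.
  apply: cvgD.
    apply: cvgD; last exact: sqU.
    by apply: cvgB; [exact: cvg_cst|apply: cvg_dotv => //; exact: yU].
  apply: cvgM; first exact: cvg_cst.
  by apply: cvg_lin_viol => //; exact: cvg_cst.
suff : g0 zb - dotv v0 0 - 0 * enorm (y - zb) + r / 2 * enorm (y - zb) ^+ 2 <=
    g0 y - dotv v0 (y - zb) + r / 2 * enorm (y - zb) ^+ 2
      + beta K * lin_viol g1 h1 zb v1 y by rewrite dotv0r; lra.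
apply: (ler_cvg_to lhsU rhsU); apply: Uoo; exists K.+1 => // n; exact: VI.
Qed.
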